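(* Let $\mathcal{X}$ be the instance space, $\mathcal{T}$ a finite representation space, $p(t|x)$ an encoder from $\mathcal{X}$ to $\mathcal{T}$, and let $p(x)$, $q(x)$ be the source and target instance distributions, inducing $p(t)$ and $q(t)$ on $\mathcal{T}$. Let $\mathcal{H}$ be a set of classifiers $h:\mathcal{T}\to\mathcal{Y}$ and $h^*\in\mathcal{H}$ the classifier minimizing the sum of the source and target expected errors. Let $\delta\in(0,1)$, and let $m$ source instances be sampled i.i.d. from $p(x)$ and $m$ target instances i.i.d. from $q(x)$, with set of correspondence pairs $\mathcal{CP}$ (a one-to-one matching of the source sample with the target sample). Then, with probability at least $1-\delta$ over the samples, $$d_{\mathcal{H}\Delta\mathcal{H}}(p(t),q(t))\le \frac1m\sum_{(x_S,x_T)\in\mathcal{CP}}\|p(t|x_S)-p(t|x_T)\|_1+\epsilon,\qquad \epsilon=2\sqrt{|\mathcal{T}|}\,\frac{2+\sqrt{2\log(1/\delta)}}{\sqrt m}.$$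
   Context: $p(t)=\sum_x p(t|x)p(x)$ and $q(t)=\sum_x p(t|x)q(x)$; the encoder is the same on both domains and is fixed (it does not depend on the samples). With $f:\mathcal{T}\to\mathcal{Y}$ the (fixed) ground-truth-induced labeling function, the expected errors are $\epsilon_S(h)=E_{t\sim p(t)}I_{\{f(t)\ne h(t)\}}$ and $\epsilon_T(h)=E_{t\sim q(t)}I_{\{f(t)\neq h(t)\}}$, and $h^*=\operatorname{argmin}_{h\in\mathcal{H}}\,(\epsilon_S(h)+\epsilon_T(h))$. The representation discrepancy is $$d_{\mathcal{H}\Delta\mathcal{H}}(p(t),q(t))=\sup_{h\in\mathcal{H}}\left|E_{t\sim p(t)}I_{\{h^*(t)\ne h(t)\}}-E_{t\sim q(t)}I_{\{h^*(t)\neq h(t)\}}\right|.$$ Here $I_{\{\cdot\}}$ is the indicator function and $\|p(t|x_S)-p(t|x_T)\|_1=\sum_{t\in\mathcal{T}}|p(t|x_S)-p(t|x_T)|$. The set $\mathcal{CP}=\{(x_{S,i},x_{T,i})\}_{i=1}^m$ of correspondence pairs is a one-to-one pairing of the source sample (as an indexed family of $m$ instances) with the target sample that minimizes $\sum_{i=1}^m\|p(t|x_{S,i})-p(t|x_{T,i})\|_1$ among all such pairings. All logarithms are natural. *)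

(* Defs.v *)
From mathcomp Require Import all_boot all_order all_algebra all_fingroup.
From mathcomp Require Import all_classical all_reals all_analysis.
From mathcomp Require Import measurable_realfun.

Set Implicit Arguments.
Unset Strict Implicit.
Unset Printing Implicit Defensive.

Import Order.TTheory GRing.Theory Num.Theory.
Import numFieldNormedType.Exports.

Local Open Scope classical_set_scope.
Local Open Scope ring_scope.

(* [enc x t] is the conditional probability p(t|x). *)
Record is_encoder (R : realType) (d : measure_display) (X : measurableType d)
    (T : finType) (enc : X -> T -> R) : Prop := IsEncoder {
  encoder_measurable : forall t, measurable_fun setT (fun x => enc x t) ;
  encoder_ge0 : forall x t, 0 <= enc x t ;
  encoder_sum1 : forall x, \sum_(t : T) enc x t = 1 }.

(* The law p(t) induced by an instance distribution. The instance space is an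
   arbitrary measurable space, so the average of p(t|x) over x is an integral;
   [repr_law_discrete] shows that it is sum_x p(t|x)p(x) when the instance
   distribution is discrete. *)
Definition repr_law (R : realType) (d : measure_display) (X : measurableType d)
    (T : finType) (p : probability X R) (enc : X -> T -> R) (t : T) : R :=
  Rintegral p setT (fun x => enc x t).

Lemma repr_law_discrete (R : realType) (d : measure_display)
    (X : measurableType d) (T : finType) (p : probability X R)
    (enc : X -> T -> R) (D : set X) (t : T) :
  is_encoder enc -> (forall x, measurable [set x : X]) ->
  countable D -> p D = 1%E ->
  ((repr_law p enc t)%:E = \esum_(x in D) ((enc x t)%:E * p [set x]))%E.
Proof.
move=> [menc enc0 enc1] mX cD pD.
have mD : measurable D := countable_measurable mX cD.
pose g x := (enc x t)%:E.
have mg A : measurable A -> measurable_fun A g.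
  move=> mA; apply/measurable_EFinP.
  exact: measurable_funS (measurableT) (@subsetT _ A) (menc t).
have g0 x : (0 <= g x)%E by rewrite lee_fin.
have /countable_injP[e inje] := cD.
pose F k := D `&` e @^-1` [set k].
have DF : \bigcup_k F k = D.
  by apply/seteqP; split => [x [k _ []]//|x Dx]; exists (e x).
have tF : trivIset setT F.
  apply/trivIsetP => i j _ _ ij; apply/seteqP; split => // x [[_ /= xi] [_ /= xj]].
  by move: ij; rewrite -xi -xj eqxx.
have mF k : measurable (F k).
  by apply: countable_measurable => //; apply: sub_countable cD; apply: subset_card_le => x [].
have eF k : (\int[p]_(x in F k) g x = \esum_(x in F k) (g x * p [set x]))%E.
  have [->|/set0P[x [Dx ekx]]] := eqVneq (F k) set0.
    by rewrite integral_set0 esum_set0.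
  have -> : F k = [set x].
    apply/seteqP; split => [y [Dy eky]|y ->//].
    by apply: inje; rewrite ?inE// eky ekx.
  rewrite esum_set1 ?mule_ge0 //.
  by rewrite -integral_cst//; apply: eq_integral => y; rewrite inE => ->.
have gint : (\int[p]_x g x = \esum_(x in D) (g x * p [set x]))%E.
  rewrite (@ge0_negligible_integral _ _ _ p setT (~` D))//; last 3 first.
  - exact: measurableC.
  - exact: mg.
  - by have := probability_setC p mD; rewrite pD subee.
  rewrite setDE setCK setTI -DF ge0_integral_bigcup//; last by apply: mg; rewrite DF.
  rewrite esum_bigcupT// => [|x]; last exact: mule_ge0.
  rewrite nneseries_esumT; first by apply: eq_esum => k _; exact: eF.
  by move=> k; apply: integral_ge0.
rewrite -gint /repr_law /Rintegral fineK//.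
have g1 : (\int[p]_x g x <= \int[p]_x (cst 1 x))%E.
  apply: ge0_le_integral => //; first exact: mg.
  move=> x _; rewrite lee_fin -(enc1 x) (bigD1 t)//= lerDl.
  by rewrite sumr_ge0.
rewrite ge0_fin_numE; last by apply: integral_ge0 => x _; exact: g0.
apply: (le_lt_trans g1).
have -> : (\int[p]_x (cst 1 x) = 1 :> \bar R)%E.
  by rewrite integral_cst// mul1e; exact: probability_setT.
exact: ltry.
Qed.

(* Expectation of the indicator of {g(t) <> h(t)} for t of law r on T. *)
Definition disagreement (R : realType) (T : finType) (Y : Type)
    (r : T -> R) (g h : T -> Y) : R :=
  \sum_(t : T) r t * \1_[set t' | g t' <> h t'] t.

Definition is_joint_minimizer (R : realType) (T : finType) (Y : Type)
    (pt qt : T -> R) (f : T -> Y) (H : set (T -> Y)) (hstar : T -> Y) : Prop :=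
  H hstar /\
  forall h, H h ->
    disagreement pt f hstar + disagreement qt f hstar <=
    disagreement pt f h + disagreement qt f h.

(* For probability vectors pt and qt this is the supremum of a subset of [0, 1],
   nonempty if H is. *)
Definition dHDH (R : realType) (T : finType) (Y : Type)
    (H : set (T -> Y)) (hstar : T -> Y) (pt qt : T -> R) : R :=
  sup [set `|disagreement pt hstar h - disagreement qt hstar h| | h in H].

Definition l1dist (R : realType) (T : finType) (u v : T -> R) : R :=
  \sum_(t : T) `|u t - v t|.

(* A pairing of two samples of size m is a permutation s of the indices:
   xS i is paired with xT (s i). *)
Definition pairing_cost (R : realType) (X : Type) (T : finType) (m : nat)
    (enc : X -> T -> R) (xS xT : 'I_m -> X) (s : 'S_m) : R :=
  \sum_(i < m) l1dist (enc (xS i)) (enc (xT (s i))).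

Definition is_correspondence (R : realType) (X : Type) (T : finType) (m : nat)
    (enc : X -> T -> R) (xS xT : 'I_m -> X) (s : 'S_m) : Prop :=
  forall s' : 'S_m, pairing_cost enc xS xT s <= pairing_cost enc xS xT s'.

Definition mutually_independent (R : realType) (d d' : measure_display)
    (Omega : measurableType d') (X : measurableType d) (P : probability Omega R)
    (I : finType) (Z : I -> {RV P >-> X}) : Prop :=
  forall (J : {set I}) (A : I -> set X), (forall i, measurable (A i)) ->
    (P (\bigcap_(i in [set` J]) (Z i @^-1` A i)) =
     \prod_(i in J) P (Z i @^-1` A i))%E.

(* Laws are compared on measurable sets only: the values of a measure on other
   sets carry no meaning. *)
Definition iid (R : realType) (d d' : measure_display)
    (Omega : measurableType d') (X : measurableType d) (P : probability Omega R)
    (I : finType) (Z : I -> {RV P >-> X}) (p : probability X R) : Prop :=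
  mutually_independent Z /\
  forall i (A : set X), measurable A -> distribution P (Z i) A = p A.

(* Main.v *)
(* Each disagreement set is a subset A of T, so it suffices to bound p(A) - q(A)
   for all A. Up to the deviations of the empirical averages of p(A|x) over each
   sample, it is the difference of the two empirical laws, and for any pairing
   this is at most the mean l1 distance of the pairs. By Hoeffding and a union
   bound over the 2^|T| subsets and the two samples, no empirical average exceeds
   its mean by s = epsilon / 2 except with probability at most
   2 * 2^|T| * exp(- m s^2 / 2) <= delta; passing to the complement of A turns
   this into two-sided control. *)
Require Import Defs.
From mathcomp Require Import all_boot all_order all_algebra all_fingroup.
From mathcomp Require Import all_classical all_reals all_analysis.
From mathcomp Require Import measurable_realfun ring lra.

Set Implicit Arguments.
Unset Strict Implicit.
Unset Printing Implicit Defensive.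

Import Order.TTheory GRing.Theory Num.Theory.
Import numFieldNormedType.Exports.

Local Open Scope classical_set_scope.
Local Open Scope ring_scope.

Import HBNNSimple.

(** * Exponential moments of a variable with values in the unit interval *)

(** Squaring [1 - x / 2 <= expR (- (x / 2))] and inverting bounds [expR x] by the inverse of
    [(1 - x / 2) ^+ 2]. The rest is polynomial: the right-hand side times that square exceeds 1 by
    [x ^+ 2 * (1 - x) * (5 / 2 - x) / 2], which is nonnegative for [x <= 1]. *)
Lemma expR_le_quadratic (R : realType) (x : R) : x <= 1 ->
  expR x <= 1 + x + 2 * x ^+ 2.
Proof.
move=> x1; have h0 : 0 < 1 - x / 2 by lra.
have h1 : (1 - x / 2) ^+ 2 <= expR (- x).
  have -> : expR (- x) = expR (- (x / 2)) ^+ 2.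
    by rewrite -expRM_natl; congr expR; field.
  by apply: lerXn2r; rewrite ?nnegrE ?expR_ge0 ?(ltW h0) ?(expR_ge1Dx (- (x / 2))).
rewrite expRN in h1.
have h2 : expR x <= ((1 - x / 2) ^+ 2)^-1.
  by rewrite -[leLHS]invrK lef_pV2// posrE ?invr_gt0 ?expR_gt0// exprn_gt0.
apply: (le_trans h2); rewrite -[leRHS]mul1r -[leLHS]mul1r ler_pdivrMr ?exprn_gt0//.
have -> : 1 * (1 + x + 2 * x ^+ 2) * (1 - x / 2) ^+ 2
  = 1 + x ^+ 2 * (1 - x) * (5/2 - x) / 2 by field.
have x1' : 0 <= 1 - x by lra.
have x2' : 0 <= 5 / 2 - x by lra.
rewrite lerDl divr_ge0// mulr_ge0// mulr_ge0 ?sqr_ge0//.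
Qed.

Lemma bounded_integrable (d : measure_display) (T : measurableType d)
    (R : realType) (P : probability T R) (f : T -> R) (M : R) :
  measurable_fun setT f -> (forall x, `|f x| <= M) ->
  P.-integrable setT (EFin \o f).
Proof.
move=> mf fM; apply: (@le_integrable _ _ _ P _ measurableT _ (EFin \o cst M)).
- exact/measurable_EFinP.
- by move=> x _ /=; rewrite lee_fin (le_trans (fM x))// ler_norm.
- exact: (finite_measure_integrable_cst P M measurableT).
Qed.

(* Since [0 <= g <= 1] gives [g ^+ 2 <= g], the quadratic bound on the exponential
   is dominated by an affine function of [g], whose integral is explicit. *)
Lemma mgf_unit_interval (d : measure_display) (T : measurableType d)
    (R : realType) (P : probability T R) (g : T -> R) (l : R) :
  measurable_fun setT g -> (forall x, 0 <= g x <= 1) -> 0 <= l <= 1 ->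
  (\int[P]_x (expR (l * (g x - \int[P]_y g y)))%:E <= (expR (l ^+ 2 / 2))%:E)%E.
Proof.
move=> mg g01 /andP[l0 l1]; set mu := Rintegral _ _ _.
have ig : P.-integrable setT (EFin \o g).
  apply: (@bounded_integrable _ _ _ _ _ 1) => // x.
  by have /andP[? ?] := g01 x; rewrite ger0_norm.
have mu0 : 0 <= mu by apply: Rintegral_ge0 => x _; have /andP[] := g01 x.
have P1 : P setT = 1%E by exact: probability_setT.
have icst (c : R) : P.-integrable setT (EFin \o cst c).
  exact: (finite_measure_integrable_cst P c measurableT).
have Icst (c : R) : \int[P]_x c = c by rewrite Rintegral_cst//= P1 mulr1.
have mu1 : mu <= 1.
  rewrite -(Icst 1); apply: le_Rintegral => //; first exact: (icst 1).
  move=> x _.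
  by have /andP[] := g01 x.
(* [a] and [b] are the coefficients left after expanding [1 + y + 2 * y ^+ 2] at
   [y = l * (g x - mu)] and replacing [g x ^+ 2] by [g x]. *)
pose a := 1 - l * mu + 2 * l ^+ 2 * mu ^+ 2.
pose b := l + 2 * l ^+ 2 * (1 - 2 * mu).
have ibg : P.-integrable setT (EFin \o (fun x => b * g x)).
  by rewrite (_ : _ \o _ = (fun x => b%:E * (g x)%:E)%E)//; exact: integrableZl.
have iab : P.-integrable setT (EFin \o (fun x => a + b * g x)).
  exact: (integrableD measurableT (icst a) ibg).
have Iab : (\int[P]_x (a + b * g x)%:E = (a + b * mu)%:E)%E.
  rewrite -[LHS]fineK; last exact: integrable_fin_num.
  congr EFin; rewrite -/(Rintegral _ _ _) RintegralD//; last exact: (icst a).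
  by rewrite Icst RintegralZl.
apply: (@le_trans _ _ (a + b * mu)%:E).
  rewrite -Iab; apply: ge0_le_integral => //.
  - apply/measurable_EFinP; apply: measurableT_comp => //.
    by apply: measurable_funM => //; apply: measurable_funB.
  - by have /integrableP[] := iab.
  - move=> x _; rewrite lee_fin; have /andP[g0 g1] := g01 x.
    apply: le_trans (expR_le_quadratic _) _.
      have gm : g x - mu <= 1 by lra.
      by apply: le_trans (ler_wpM2l l0 gm) _; rewrite mulr1.
    have : 0 <= l ^+ 2 * (g x - g x ^+ 2).
      by rewrite mulr_ge0 ?sqr_ge0// subr_ge0 expr2 ler_piMl.
    by rewrite /a /b; lra.
(* Here [a + b * mu = 1 + 2 * l ^+ 2 * mu * (1 - mu)], and [4 * mu * (1 - mu) <= 1] is the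
   nonnegativity of [(1 - 2 * mu) ^+ 2]; this leaves [1 + l ^+ 2 / 2]. *)
rewrite lee_fin; apply: le_trans (expR_ge1Dx _).
have : 0 <= l ^+ 2 * (1 - 2 * mu) ^+ 2 by rewrite mulr_ge0 ?sqr_ge0.
by rewrite /a /b; lra.
Qed.

(** * Products of independent variables, Hoeffding's inequality and the union bound *)

(** The identity assumed for indicators extends to simple functions by linearity and to [g] by
    monotone convergence. In its use below, [G] is the product of all factors but one and [c] the
    product of their integrals. *)
Lemma ge0_integral_comp_weight (d d' : measure_display) (W : measurableType d')
    (X : measurableType d) (R : realType) (P : {measure set W -> \bar R})
    (G : W -> R) (Z : {mfun W >-> X}) (c : R) (g : X -> R) :
  measurable_fun setT G -> (forall w, 0 <= G w) -> 0 <= c ->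
  (forall A, measurable A ->
    \int[P]_w (G w * \1_A (Z w))%:E = c%:E * P (Z @^-1` A))%E ->
  measurable_fun setT g -> (forall x, 0 <= g x) ->
  (\int[P]_w (G w * g (Z w))%:E = c%:E * \int[P]_w (g (Z w))%:E)%E.
Proof.
move=> mG G0 c0 hA mg g0.
have mZ : measurable_fun setT Z by [].
have mge : measurable_fun setT (EFin \o g) by apply/measurable_EFinP.
pose h := nnsfun_approx measurableT mge.
have hcvg w : (h n (Z w))%:E @[n --> \oo] --> (g (Z w))%:E.
  by apply: (@cvg_nnsfun_approx _ _ _ _ measurableT _ mge) => // x _; rewrite lee_fin.
have hnd w : nondecreasing_seq (fun n => h n (Z w)).
  by move=> a b ab; exact/lefP/nd_nnsfun_approx.
have mhZ n : measurable_fun setT (fun w => h n (Z w)).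
  by apply: measurableT_comp => //; exact: measurable_funP.
have -> : (\int[P]_w (g (Z w))%:E = limn (fun n => \int[P]_w (h n (Z w))%:E))%E.
  rewrite -monotone_convergence//.
  - by apply: eq_integral => w _; apply/esym/cvg_lim.
  - by move=> n; apply/measurable_EFinP.
  - by move=> n w _; rewrite lee_fin.
  - by move=> w _ a b ab; rewrite lee_fin; exact: hnd.
have -> : (\int[P]_w (G w * g (Z w))%:E
           = limn (fun n => \int[P]_w (G w * h n (Z w))%:E))%E.
  rewrite -monotone_convergence//.
  - apply: eq_integral => w _; apply/esym/cvg_lim => //.
    under eq_fun do rewrite EFinM.
    by rewrite EFinM; apply: cvgeZl.
  - by move=> n; apply/measurable_EFinP; apply: measurable_funM.
  - by move=> n w _; rewrite lee_fin mulr_ge0.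
  - by move=> w _ a b ab; rewrite lee_fin ler_wpM2l//; exact: hnd.
rewrite -limeMl//; last first.
  apply: ereal_nondecreasing_is_cvgn => a b ab; apply: ge0_le_integral => //.
  - by move=> w _; rewrite lee_fin.
  - exact/measurable_EFinP.
  - exact/measurable_EFinP.
  - by move=> w _; rewrite lee_fin; exact: hnd.
congr (limn _); apply/funext => n.
have mS r : measurable (h n @^-1` [set r]) by [].
have mI r : measurable_fun setT (fun w => \1_(h n @^-1` [set r]) (Z w) : R).
  by apply: measurableT_comp => //; exact: measurable_indic.
have r0 r : range (h n) r -> 0 <= r by move=> [x _ <-].
(* Exchanging sum and integral asks for nonnegativity at every real [r]; outside the range of [h n]
   the preimage is empty and the indicator vanishes. *)
have rI r w : 0 <= r * \1_(h n @^-1` [set r]) (Z w).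
  have [[x _ <-]|nr] := pselect (range (h n) r); first by rewrite mulr_ge0.
  rewrite indicE memNset ?mulr0//= => hr; apply: nr; exists (Z w) => //.
transitivity (\sum_(r \in range (h n)) (c%:E * (r%:E * P (Z @^-1` (h n @^-1` [set r])))))%E.
  have hE w : ((G w * h n (Z w))%:E = \sum_(r \in range (h n))
      ((G w)%:E * (r * \1_(h n @^-1` [set r]) (Z w))%:E))%E.
    rewrite fimfunE EFinM -fsumEFin// ge0_mule_fsumr// => r.
    by rewrite lee_fin.
  under eq_integral do rewrite hE.
  rewrite ge0_integral_fsum//; last 2 first.
  - move=> r; apply/measurable_EFinP => /=.
    by apply: measurable_funM => //; exact: measurable_funM.
  - by move=> r w _; rewrite -EFinM lee_fin mulr_ge0.
  apply: eq_fsbigr => r /[!inE] hr.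
  under eq_integral do rewrite -EFinM mulrCA EFinM.
  rewrite ge0_integralZl//; last 3 first.
  - by apply/measurable_EFinP; apply: measurable_funM.
  - by move=> w _; rewrite lee_fin mulr_ge0.
  - by rewrite lee_fin r0.
  by rewrite hA// muleCA.
rewrite -ge0_mule_fsumr; last first.
  move=> r; have [hr|nr] := pselect (range (h n) r).
    by rewrite mule_ge0// lee_fin r0.
  by rewrite preimage10// preimage_set0 measure0 mule0.
congr (_ * _)%E.
under [RHS]eq_integral do rewrite fimfunE -fsumEFin//.
rewrite ge0_integral_fsum//; last 2 first.
- by move=> r; apply/measurable_EFinP => /=; apply: measurable_funM.
- by move=> r w _; rewrite lee_fin.
apply: eq_fsbigr => r /[!inE] hr.
under eq_integral do rewrite EFinM.
rewrite ge0_integralZl//; last 2 first.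
- exact/measurable_EFinP.
- by rewrite lee_fin r0.
rewrite -[in LHS](setIT (Z @^-1` _)) -integral_indic//.
by rewrite -[X in measurable X]setTI; apply: mZ.
Qed.

Lemma integral_indic_comp (d d' : measure_display) (W : measurableType d')
    (X : measurableType d) (R : realType) (P : {measure set W -> \bar R})
    (Z : {mfun W >-> X}) (A : set X) : measurable A ->
  (\int[P]_w (\1_A (Z w))%:E = P (Z @^-1` A))%E.
Proof.
move=> mA; rewrite -[in RHS](setIT (Z @^-1` A)) -integral_indic//.
by rewrite -[X in measurable X]setTI; exact: measurable_funP.
Qed.

(* Independence is the case where every [phi i] is an indicator; the indicators
   are then replaced by general functions one index at a time. *)
Lemma integral_prod_independent (R : realType) (d d' : measure_display)
    (W : measurableType d') (X : measurableType d) (P : probability W R)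
    (I : finType) (Z : I -> {RV P >-> X}) (phi : I -> X -> R) :
  mutually_independent Z ->
  (forall i, measurable_fun setT (phi i)) -> (forall i x, 0 <= phi i x) ->
  (forall i, \int[P]_w (phi i (Z i w))%:E < +oo)%E ->
  (\int[P]_w (\prod_i phi i (Z i w))%:E =
   \prod_i \int[P]_w (phi i (Z i w))%:E)%E.
Proof.
move=> indZ.
(* Induction on the list [s] of indices whose factor may be arbitrary: the empty list is
   independence itself, and [enum I] is the full claim. *)
suff main (s : seq I) : forall psi : I -> X -> R,
    (forall i, measurable_fun setT (psi i)) -> (forall i x, 0 <= psi i x) ->
    (forall i, \int[P]_w (psi i (Z i w))%:E < +oo)%E ->
    (forall i, i \notin s -> exists2 A, measurable A & psi i = \1_A) ->
    (\int[P]_w (\prod_i psi i (Z i w))%:E =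
     \prod_i \int[P]_w (psi i (Z i w))%:E)%E.
  move=> mphi phi0 phioo; apply: (main (enum I)) => // i.
  by rewrite mem_enum.
elim: s => [|k s IH] psi mpsi psi0 psioo psi1.
  have /choice[A hA] : forall i, exists A, measurable A /\ psi i = \1_A.
    by move=> i; have [//|A mA eA] := psi1 i; exists A.
  pose B := \bigcap_(i in [set` [set: I]%SET]) (Z i @^-1` A i).
  have hB w : \prod_i psi i (Z i w) = \1_B w.
    have [Bw|nBw] := pselect (B w).
      rewrite indicE mem_set// big1// => i _; rewrite (hA i).2 indicE mem_set//.
      by apply: Bw; rewrite /= inE.
    rewrite indicE memNset//.
    have [i nAi] : exists i, ~ A i (Z i w).
      by apply/not_existsP => h; apply: nBw => i _; apply: contrapT; exact: h.
    by rewrite (bigD1 i)//= (hA i).2 indicE memNset// mul0r.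
  have mB : measurable B.
    apply: fin_bigcap_measurable; first exact: finite_finset.
    move=> i _; rewrite -[X in measurable X]setTI.
    by apply: measurable_funP => //; exact: (hA i).1.
  under eq_integral do rewrite hB.
  rewrite integral_indic// setIT; apply: etrans (indZ _ A (fun i => (hA i).1)) _.
  apply: eq_big => [i|i _]; first by rewrite inE.
  by rewrite (hA i).2 integral_indic_comp//; exact: (hA i).1.
have mZ i : measurable_fun setT (Z i) by exact: measurable_funP.
have fin i : (\int[P]_w (psi i (Z i w))%:E)%E \is a fin_num.
  by rewrite ge0_fin_numE// integral_ge0// => w _; rewrite lee_fin.
pose c := \prod_(i | i != k) fine (\int[P]_w (psi i (Z i w))%:E)%E.
have cE : (\prod_(i | i != k) \int[P]_w (psi i (Z i w))%:E = c%:E)%E.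
  by rewrite -prodEFin; apply: eq_bigr => i _; rewrite fineK.
pose G w := \prod_(i | i != k) psi i (Z i w).
under eq_integral do rewrite (bigD1 k)//= mulrC -/(G _).
rewrite (bigD1 k)//= cE muleC.
apply: ge0_integral_comp_weight => //.
- rewrite /G; under eq_fun do rewrite -big_filter.
  by apply: measurable_prod => i _; exact: measurableT_comp.
- by move=> w; exact: prodr_ge0.
- by apply: prodr_ge0 => i _; apply: fine_ge0; apply: integral_ge0 => w _; rewrite lee_fin.
move=> A mA.
(* With its [k]-th factor turned into an indicator, the family falls under the induction hypothesis,
   which then yields the identity on indicators that [ge0_integral_comp_weight] requires. *)
pose psi' i := if i == k then \1_A else psi i.
have psi'k : psi' k = \1_A by rewrite /psi' eqxx.
have psi'n i : i != k -> psi' i = psi i by rewrite /psi' => /negbTE ->.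
have := IH psi'; rewrite (bigD1 k)//= psi'k integral_indic_comp//.
under eq_bigr => i ik do rewrite psi'n//.
rewrite cE muleC => <-.
- apply: eq_integral => w _; rewrite (bigD1 k)//= psi'k mulrC; congr (_ * _)%:E.
  by apply: eq_bigr => i ik; rewrite psi'n.
- by move=> i; rewrite /psi'; case: eqP => // _; exact: measurable_indic.
- by move=> i x; rewrite /psi'; case: eqP.
- move=> i; have [->|ik] := eqVneq i k; last by rewrite psi'n.
  rewrite psi'k integral_indic_comp//.
  apply: le_lt_trans (probability_le1 _ _) _; last exact: ltry.
  by rewrite -[X in measurable X]setTI; exact: mZ.
- move=> i is'; have [->|ik] := eqVneq i k; first by exists A.
  rewrite psi'n//; apply: psi1; rewrite inE negb_or ik//.
Qed.

(* Chernoff's bound at parameter [s], which is admissible for [s <= 1]; for [1 < s]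
   the event is empty. *)
Lemma hoeffding_iid (R : realType) (d d' : measure_display)
    (W : measurableType d') (X : measurableType d) (P : probability W R)
    (m : nat) (Z : 'I_m -> {RV P >-> X}) (p : probability X R) (g : X -> R) (s : R) :
  (0 < m)%N -> iid Z p -> measurable_fun setT g -> (forall x, 0 <= g x <= 1) ->
  0 < s ->
  (P [set w | \int[p]_x g x + s <= m%:R^-1 * \sum_(i < m) g (Z i w)]%R
   <= (expR (- (m%:R * s ^+ 2 / 2)))%:E)%E.
Proof.
move=> m0 [indZ lawZ] mg g01 s0; set mu := Rintegral _ _ _.
have m0' : 0 < m%:R :> R by rewrite ltr0n.
have mu0 : 0 <= mu by apply: Rintegral_ge0 => x _; have /andP[] := g01 x.
have [s1|s1] := leP s 1; last first.
  rewrite (_ : [set w | _] = set0); first by rewrite measure0 lee_fin expR_ge0.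
  apply/seteqP; split => w //=; apply/negP; rewrite -ltNge.
  apply: (@le_lt_trans _ _ 1); last lra.
  rewrite ler_pdivrMl// mulr1.
  rewrite -[X in X%:R]card_ord -sumr_const.
  by apply: ler_sum => i _; have /andP[] := g01 (Z i w).
have mZ i : measurable_fun setT (Z i) by exact: measurable_funP.
pose V w := \sum_(i < m) (g (Z i w) - mu).
have mV : measurable_fun setT V.
  by apply: measurable_sum => i; apply: measurable_funB => //; exact: measurableT_comp.
pose V' : {RV P >-> R} := mfun_Sub (mem_set mV : V \in mfun).
have -> : [set w | mu + s <= m%:R^-1 * \sum_(i < m) g (Z i w)]
          = [set w | m%:R * s <= V' w].
  apply/funext => w; apply/propext; rewrite /= /V ler_pdivlMl//.
  by rewrite sumrB sumr_const card_ord -mulr_natl mulrDr; split => ?; lra.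
apply: le_trans (chernoff V' (m%:R * s) s0) _.
rewrite /mmt_gen_fun unlock.
have -> : (\int[P]_w ((expR \o s \o* V') w)%:E =
    \int[P]_w (\prod_(i < m) expR (s * (g (Z i w) - mu)))%:E)%E.
  apply: eq_integral => w _; rewrite -expR_sum/=; congr (expR _)%:E.
  by rewrite mulr_suml; apply: eq_bigr => i _; rewrite mulrC.
have mE : measurable_fun setT (fun x => expR (s * (g x - mu))).
  by apply: measurableT_comp => //; apply: measurable_funM => //; exact: measurable_funB.
have hE i : (\int[P]_w (expR (s * (g (Z i w) - mu)))%:E <= (expR (s ^+ 2 / 2))%:E)%E.
  have -> : (\int[P]_w (expR (s * (g (Z i w) - mu)))%:E
       = \int[p]_x (expR (s * (g x - mu)))%:E)%E.
    rewrite -(@eq_measure_integral _ _ _ setT p (distribution P (Z i))); last first.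
      by move=> A mA _; exact: lawZ.
    by rewrite ge0_integral_distribution//; exact/measurable_EFinP.
  by apply: mgf_unit_interval => //; rewrite (ltW s0).
rewrite (@integral_prod_independent _ _ _ _ _ _ _ Z (fun _ x => expR (s * (g x - mu))))//; last first.
  by move=> i; apply: le_lt_trans (hE i) _; exact: ltry.
have fE i : (\int[P]_w (expR (s * (g (Z i w) - mu)))%:E)%E \is a fin_num.
  rewrite ge0_fin_numE; first exact: le_lt_trans (hE i) (ltry _).
  by apply: integral_ge0 => w _; rewrite lee_fin expR_ge0.
under eq_bigr do rewrite -(fineK (fE _)).
rewrite prodEFin -EFinM lee_fin.
(* The [m] moment factors contribute [m * s ^+ 2 / 2] to the exponent and Chernoff's factor
   [- m * s ^+ 2]. Taking the deviation [s] itself as parameter minimizes [l ^+ 2 / 2 - l * s] over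
   [l]. *)
apply: (@le_trans _ _ ((\prod_(i < m) expR (s ^+ 2 / 2)) * expR (- (s * (m%:R * s))))).
  rewrite ler_pM2r ?expR_gt0//; apply: ler_prod => i _.
  rewrite -!lee_fin fineK// hE andbT.
  by apply: integral_ge0 => w _; rewrite lee_fin expR_ge0.
rewrite prodr_const card_ord -expRM_natl -expRD ler_expR.
lra.
Qed.

Lemma le_measure_bigsetU (d : measure_display) (W : measurableType d)
    (R : realType) (P : {measure set W -> \bar R}) (I : Type) (r : seq I)
    (F : I -> set W) : (forall i, measurable (F i)) ->
  (P (\big[setU/set0]_(i <- r) F i) <= \sum_(i <- r) P (F i))%E.
Proof.
move=> mF; elim: r => [|i r IH]; first by rewrite !big_nil measure0.
rewrite !big_cons; apply: le_trans (measureU2 _ _ _) _ => //.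
  exact: bigsetU_measurable.
exact: leeD.
Qed.

(** * Deterministic comparison of the discrepancy, the empirical laws and the pairing cost *)

(** Split [pt - qt] on a set as [(pt - pe) + (pe - qe) + (qe - qt)]. The last term is an upper
    deviation of [qe]; the first becomes an upper deviation of [pe] on the complement, because [pe]
    and [pt] have the same total. *)
Lemma dHDH_le_l1dist (R : realType) (T : finType) (Y : Type)
    (H : set (T -> Y)) (hstar : T -> Y) (pt qt pe qe : T -> R) (s : R) :
  H hstar -> \sum_t pe t = \sum_t pt t -> \sum_t qt t = \sum_t pt t ->
  \sum_t qe t = \sum_t pt t ->
  (forall A : {set T}, \sum_(t in A) pe t <= \sum_(t in A) pt t + s) ->
  (forall A : {set T}, \sum_(t in A) qe t <= \sum_(t in A) qt t + s) ->
  dHDH H hstar pt qt <= l1dist pe qe + 2 * s.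
Proof.
move=> Hh epe eqt eqe hp hq.
have setCE (u : T -> R) (A : {set T}) :
    \sum_(t in ~: A) u t = \sum_t u t - \sum_(t in A) u t.
  apply: (canRL (addrK _)); rewrite addrC [RHS](bigID [in A])/=.
  by congr (_ + _); apply: eq_bigl => t; rewrite inE.
have le_pq (A : {set T}) :
    \sum_(t in A) pt t - \sum_(t in A) qt t <= l1dist pe qe + 2 * s.
  have h1 : \sum_(t in A) pe t - \sum_(t in A) qe t <= l1dist pe qe.
    rewrite -sumrB /l1dist [leRHS](bigID [in A])/= -[leLHS]addr0.
    by apply: lerD; [apply: ler_sum => t _; exact: ler_norm|exact: sumr_ge0].
  have := hp (~: A); rewrite !setCE epe; have := hq A; lra.
(* The opposite sign comes from the same bound on the complement, as [pt] and [qt] have equal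
   totals. *)
have le_qp (A : {set T}) :
    \sum_(t in A) qt t - \sum_(t in A) pt t <= l1dist pe qe + 2 * s.
  have := le_pq (~: A); rewrite !setCE eqt; lra.
(* [hstar] compared with itself shows that the supremum is over a nonempty set. *)
apply: ge_sup; first by exists `|disagreement pt hstar hstar - disagreement qt hstar hstar|, hstar.
move=> _ [h Hh' <-].
pose A : {set T} := [set t | `[< hstar t <> h t >]]%SET.
have dA u : disagreement u hstar h = \sum_(t in A) u t.
  rewrite /disagreement [RHS]big_mkcond/=; apply: eq_bigr => t _.
  rewrite inE indicE; case: asboolP => ht.
    by rewrite mem_set// mulr1.
  by rewrite memNset// mulr0.
by rewrite !dA ler_norml lerNl opprB le_qp le_pq.
Qed.

Definition empirical_law (R : realType) (X : Type) (T : finType) (m : nat)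
    (enc : X -> T -> R) (x : 'I_m -> X) (t : T) : R :=
  m%:R^-1 * \sum_(i < m) enc (x i) t.

Lemma sum_empirical_law (R : realType) (X : Type) (T : finType) (m : nat)
    (enc : X -> T -> R) (x : 'I_m -> X) (A : {set T}) :
  \sum_(t in A) empirical_law enc x t =
  m%:R^-1 * \sum_(i < m) \sum_(t in A) enc (x i) t.
Proof. by rewrite -mulr_sumr exchange_big. Qed.

(** An empirical law does not depend on the order of its sample, so the second sample can be
    reindexed by [s]; the triangle inequality is then applied at each [t]. Optimality of the pairing
    plays no part at this point. *)
Lemma l1dist_empirical_law (R : realType) (X : Type) (T : finType) (m : nat)
    (enc : X -> T -> R) (xS xT : 'I_m -> X) (s : 'S_m) :
  l1dist (empirical_law enc xS) (empirical_law enc xT) <=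
  m%:R^-1 * pairing_cost enc xS xT s.
Proof.
rewrite /pairing_cost /l1dist exchange_big mulr_sumr/=.
apply: ler_sum => t _; rewrite /empirical_law.
rewrite [X in _ - _ * X](reindex_inj (@perm_inj _ s))/= -mulrBr -sumrB.
by rewrite normrM ger0_norm// ler_wpM2l// ler_norm_sum.
Qed.

(** * Masses of subsets of [T] under the encoder, the induced law and the empirical law *)

Lemma measurable_encoder_sum (R : realType) (d : measure_display)
    (X : measurableType d) (T : finType) (enc : X -> T -> R)
    (A : {set T}) :
  is_encoder enc -> measurable_fun setT (fun x => \sum_(t in A) enc x t).
Proof.
move=> henc; under eq_fun do rewrite -big_filter.
by apply: measurable_sum => t; exact: encoder_measurable henc t.
Qed.

Lemma encoder_sum_itv (R : realType) (d : measure_display)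
    (X : measurableType d) (T : finType) (enc : X -> T -> R)
    (A : {set T}) (x : X) :
  is_encoder enc -> 0 <= \sum_(t in A) enc x t <= 1.
Proof.
move=> henc; rewrite sumr_ge0/=; last by move=> t _; exact: encoder_ge0 henc x t.
rewrite -(encoder_sum1 henc x) [leRHS](bigID [in A])/= lerDl.
by apply: sumr_ge0 => t _; exact: encoder_ge0 henc x t.
Qed.

(** Presents the mass of [A] as the mean of a function of [x] with values in the unit interval, the
    form in which [hoeffding_iid] applies. *)
Lemma sum_repr_law (R : realType) (d : measure_display)
    (X : measurableType d) (T : finType) (enc : X -> T -> R)
    (p : probability X R) (A : {set T}) :
  is_encoder enc ->
  \sum_(t in A) repr_law p enc t = \int[p]_x (\sum_(t in A) enc x t).
Proof.
move=> henc; have enc01 x t : `|enc x t| <= 1.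
  have := encoder_sum_itv [set t]%SET x henc.
  by rewrite big_set1 => /andP[e0 e1]; rewrite ger0_norm.
have ienc t : p.-integrable setT (EFin \o (enc^~ t)).
  apply: (@bounded_integrable _ _ _ _ _ 1) => //; exact: encoder_measurable henc t.
rewrite /repr_law /Rintegral.
have -> : (\int[p]_x (\sum_(t in A) enc x t)%:E =
    \sum_(t in A) \int[p]_x (enc x t)%:E)%E.
  by under eq_integral do rewrite -sumEFin; rewrite integral_sum.
rewrite -sum_fine// => t _; exact: integrable_fin_num (ienc t).
Qed.

Lemma sum_repr_law1 (R : realType) (d : measure_display)
    (X : measurableType d) (T : finType) (enc : X -> T -> R)
    (p : probability X R) :
  is_encoder enc -> \sum_t repr_law p enc t = 1.
Proof.
move=> henc; transitivity (\sum_(t in [set: T]%SET) repr_law p enc t).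
  by apply: eq_bigl => t; rewrite inE.
rewrite sum_repr_law// -[RHS]/(fine 1%E) -(@probability_setT _ _ _ p) -[RHS]mul1r.
rewrite -Rintegral_cst//; apply: eq_Rintegral => x _.
by rewrite -(encoder_sum1 henc x); apply: eq_bigl => t; rewrite inE.
Qed.

Lemma sum_empirical_law1 (R : realType) (d : measure_display)
    (X : measurableType d) (T : finType) (enc : X -> T -> R)
    (m : nat) (x : 'I_m -> X) :
  is_encoder enc -> (0 < m)%N ->
  \sum_t empirical_law enc x t = 1.
Proof.
move=> henc m0; rewrite -mulr_sumr exchange_big/=.
under eq_bigr do rewrite (encoder_sum1 henc).
by rewrite sumr_const card_ord mulVf// pnatr_eq0 -lt0n.
Qed.

(** * Probability of an excessive empirical mass, and the choice of the deviation level *)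

(** The bad event of one sample. It is one-sided, but the union runs over all subsets and hence over
    complements too, so outside it the deviations are controlled on both sides. *)
Definition overshoot (R : realType) (d : measure_display)
    (X : measurableType d) (T : finType) (W : Type) (m : nat)
    (enc : X -> T -> R) (p : probability X R) (Z : 'I_m -> W -> X) (s : R) : set W :=
  \big[setU/set0]_(A : {set T}) [set w | \sum_(t in A) repr_law p enc t + s <=
    \sum_(t in A) empirical_law enc (fun i => Z i w) t].

Lemma measurable_empirical_law_ge (R : realType) (d d' : measure_display)
    (X : measurableType d) (T : finType) (enc : X -> T -> R)
    (W : measurableType d') (P : probability W R) (m : nat)
    (Z : 'I_m -> {RV P >-> X}) (c : R) (A : {set T}) :
  is_encoder enc ->
  measurable [set w | c <= \sum_(t in A) empirical_law enc (fun i => Z i w) t].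
Proof.
move=> henc; rewrite -preimage_itvcy -[X in measurable X]setTI.
suff mf : measurable_fun setT
    (fun w => \sum_(t in A) empirical_law enc (fun i => Z i w) t).
  by apply: mf => //; exact: measurable_itv.
under eq_fun do rewrite sum_empirical_law.
apply: measurable_funM => //; apply: measurable_sum => i.
by apply: (measurableT_comp (measurable_encoder_sum A henc)); exact: measurable_funP.
Qed.

Lemma probability_overshoot (R : realType) (d d' : measure_display)
    (X : measurableType d) (T : finType) (enc : X -> T -> R)
    (W : measurableType d') (P : probability W R) (m : nat)
    (Z : 'I_m -> {RV P >-> X}) (p : probability X R) (s : R) :
  is_encoder enc -> (0 < m)%N -> iid Z p -> 0 < s ->
  (P (overshoot enc p Z s) <= (2 ^+ #|T| * expR (- (m%:R * s ^+ 2 / 2)))%:E)%E.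
Proof.
move=> henc m0 iidZ s0.
apply: le_trans (le_measure_bigsetU _ _ _) _ => [A|]; first exact: measurable_empirical_law_ge.
apply: (@le_trans _ _ (\sum_(A : {set T}) (expR (- (m%:R * s ^+ 2 / 2)))%:E)%E).
  apply: lee_sum => A _.
  under eq_set do rewrite (sum_repr_law _ _ henc) sum_empirical_law.
  by apply: hoeffding_iid => //; [exact: measurable_encoder_sum|move=> x; exact: encoder_sum_itv].
rewrite sumEFin lee_fin sumr_const (_ : #|{: {set T}}| = (2 ^ #|T|)%N).
  by rewrite -[leLHS]mulr_natl natrX.
by rewrite -(cardsT T) -card_powerset; apply: eq_card => A; rewrite powersetE finset.subsetT.
Qed.

(** With [K = ln (1 / delta)], the exponent is [n * (2 + sqrt (2 * K)) ^+ 2 / 2]. Its square expands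
    to [2 * n], a nonnegative cross term and [n * K >= K]. Then [expR (- K)] is [delta], while
    [expR (- (2 * n)) <= 4^-1 ^+ n] absorbs the number [2 ^+ n] of subsets. *)
Lemma expR_deviation_level_le (R : realType) (n m : nat) (delta : R) :
  (0 < n)%N -> (0 < m)%N -> 0 < delta < 1 ->
  let s := Num.sqrt n%:R * ((2 + Num.sqrt (2 * ln (1 / delta))) / Num.sqrt m%:R) in
  2 * (2 ^+ n * expR (- (m%:R * s ^+ 2 / 2))) <= delta.
Proof.
move=> n0 m0 /andP[d0 d1]; set s := _ * (_ / _) => /=.
have m0' : 0 < m%:R :> R by rewrite ltr0n.
have n1 : 1 <= n%:R :> R by rewrite ler1n.
set K := ln (1 / delta).
have dE : delta = expR (- K).
  by rewrite /K div1r lnV ?posrE// opprK lnK ?posrE.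
have K0 : 0 <= K by rewrite ln_ge0// div1r invf_ge1// ltW.
have e2 : 4 <= expR 2 :> R.
  have -> : 2 = 1 + 1 :> R by [].
  have h : 2 <= expR 1 :> R by have := expR_ge1Dx (1 : R); lra.
  by rewrite expRD (_ : 4 = 2 * 2 :> R) ?ler_pM//; ring.
have em2 : expR (- (2 * n%:R)) <= 4^-1 ^+ n :> R.
  rewrite -mulNr mulrC expRM_natl lerXn2r ?nnegrE ?expR_ge0//.
  by rewrite expRN lef_pV2// posrE ?expR_gt0.
have sE : 2 * n%:R + K <= m%:R * s ^+ 2 / 2.
  have -> : m%:R * s ^+ 2 / 2 = n%:R * (2 + Num.sqrt (2 * K)) ^+ 2 / 2.
    rewrite /s !exprMn exprVn !sqr_sqrtr ?ler0n// -/K.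
    by field; rewrite gt_eqF.
  have r2 : Num.sqrt (2 * K) ^+ 2 = 2 * K by rewrite sqr_sqrtr ?mulr_ge0.
  have r0 : 0 <= n%:R * Num.sqrt (2 * K) by rewrite mulr_ge0// sqrtr_ge0.
  have -> : n%:R * (2 + Num.sqrt (2 * K)) ^+ 2 / 2 =
      2 * n%:R + 2 * (n%:R * Num.sqrt (2 * K)) + n%:R * K.
    by rewrite sqrrD r2; field.
  have nK : K <= n%:R * K by rewrite ler_peMl.
  lra.
apply: (@le_trans _ _ (2 * (2 ^+ n * (4^-1 ^+ n * delta)))).
  rewrite ler_pM2l// ler_pM2l ?exprn_gt0//.
  apply: (@le_trans _ _ (expR (- (2 * n%:R) - K))); first by rewrite ler_expR; lra.
  by rewrite expRD -dE ler_pM2r.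
have -> : 2 * (2 ^+ n * (4^-1 ^+ n * delta)) = 2 * 2^-1 ^+ n * delta.
  have -> : 2^-1 = 2 * 4^-1 :> R by field.
  by rewrite exprMn !mulrA.
rewrite -[leRHS]mul1r ler_pM2r//.
(* What remains is [2 * 2^-1 ^+ n <= 1]: since [n] is positive, one factor [2^-1] cancels the 2 that
   counts the samples. *)
rewrite -(prednK n0) exprS mulrA divff// mul1r exprn_ile1//.
by rewrite invf_le1// ler1n.
Qed.

(** * Measurability of the good event and the union bound over the two samples *)

Theorem proposition1 (R : realType)
    (d : measure_display) (X : measurableType d) (T : finType) (Y : Type)
    (enc : X -> T -> R) (henc : is_encoder enc)
    (p q : probability X R)
    (f : T -> Y) (H : set (T -> Y)) (hstar : T -> Y)
    (hhstar : is_joint_minimizer (repr_law p enc) (repr_law q enc) f H hstar)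
    (delta : R) (hdelta : 0 < delta < 1)
    (m : nat) (hm : (0 < m)%N)
    (d' : measure_display) (Omega : measurableType d') (P : probability Omega R)
    (XS XT : 'I_m -> {RV P >-> X}) (hXS : iid XS p) (hXT : iid XT q)
    (CP : Omega -> 'S_m)
    (hCP : forall w : Omega,
       is_correspondence enc (fun i => XS i w) (fun i => XT i w) (CP w)) :
  let epsilon : R :=
    2 * Num.sqrt #|T|%:R *
      ((2 + Num.sqrt (2 * ln (1 / delta))) / Num.sqrt m%:R) in
  ((1 - delta)%:E <=
   P [set w | (dHDH H hstar (repr_law p enc) (repr_law q enc) <=
               1 / m%:R *
                 \sum_(i < m) l1dist (enc (XS i w)) (enc (XT (CP w i) w))
               + epsilon)%R])%E.
Proof.
cbv zeta; set epsilon := 2 * _ * _; set C := dHDH _ _ _ _.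
pose s : R := Num.sqrt #|T|%:R *
  ((2 + Num.sqrt (2 * ln (1 / delta))) / Num.sqrt m%:R).
have epsE : epsilon = 2 * s by rewrite /epsilon -mulrA.
(* Over an empty [T] the encoder at [point] would sum to 0 instead of 1. Positivity of [#|T|] gives
   [0 < s] and is the condition on [n] in [expR_deviation_level_le]. *)
have T0 : (0 < #|T|)%N.
  rewrite lt0n; apply/negP => /eqP T0; have := encoder_sum1 henc point.
  rewrite big1 => [/esym/eqP|t _]; first by rewrite oner_eq0.
  by have := max_card (pred1 t); rewrite T0 card1.
have s0 : 0 < s.
  by rewrite /s mulr_gt0 ?sqrtr_gt0 ?ltr0n// divr_gt0 ?sqrtr_gt0 ?ltr0n//.
set good := [set w | _].
pose cost w (sg : 'S_m) := pairing_cost enc (XS^~ w) (XT^~ w) sg.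
(* [CP] need not be measurable; minimality makes the event one about all pairings. *)
have goodE : good = \bigcap_(sg in [set: 'S_m])
    [set w | C <= m%:R^-1 * cost w sg + epsilon].
  apply/seteqP; split => w /=; rewrite /good /= div1r => h.
    move=> sg _ /=; apply: (le_trans h); rewrite lerD2r ler_wpM2l ?invr_ge0//.
    exact: hCP w sg.
  exact: (h (CP w) Logic.I).
have mcost sg : measurable_fun setT (fun w => cost w sg).
  apply: measurable_sum => i; apply: measurable_sum => t.
  apply: measurableT_comp => //; apply: measurable_funB.
    by apply: (measurableT_comp (encoder_measurable henc t)); exact: measurable_funP.
  by apply: (measurableT_comp (encoder_measurable henc t)); exact: measurable_funP.
have mgood : measurable good.
  rewrite goodE; apply: fin_bigcap_measurable => [|sg _]; first exact: finite_finset.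
  rewrite -preimage_itvcy -[X in measurable X]setTI.
  suff mf : measurable_fun setT (fun w => m%:R^-1 * cost w sg + epsilon).
    by apply: mf => //; exact: measurable_itv.
  by apply: measurable_funD => //; exact: measurable_funM.
have mover (Z : 'I_m -> {RV P >-> X}) r : measurable (overshoot enc r Z s).
  by apply: bigsetU_measurable => A _; exact: measurable_empirical_law_ge.
(* Contrapositive: if neither sample overshoots, the deterministic comparison gives the bound for
   every pairing [sg] at once. *)
have sub : ~` good `<=` overshoot enc p XS s `|` overshoot enc q XT s.
  move=> w; apply: contra_notP => /not_orP[nS nT]; rewrite goodE => sg _ /=.
  have notover (Z : 'I_m -> {RV P >-> X}) r : ~ overshoot enc r Z s w ->
      forall A : {set T}, \sum_(t in A) empirical_law enc (Z^~ w) t <=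
        \sum_(t in A) repr_law r enc t + s.
    move=> nw A; rewrite leNgt; apply/negP => /ltW hA; apply: nw.
    by rewrite /overshoot -classical_sets.bigcup_seq; exists A => //=; rewrite mem_index_enum.
  rewrite epsE; apply: le_trans (dHDH_le_l1dist (hhstar.1) _ _ _ (notover _ _ nS) (notover _ _ nT)) _.
  - by rewrite (sum_empirical_law1 _ henc) ?(sum_repr_law1 _ henc).
  - by rewrite !(sum_repr_law1 _ henc).
  - by rewrite (sum_empirical_law1 _ henc) ?(sum_repr_law1 _ henc).
  by rewrite lerD2r; exact: l1dist_empirical_law.
have bad : (P (~` good) <= delta%:E)%E.
  apply: (@le_trans _ _ (P (overshoot enc p XS s `|` overshoot enc q XT s))).
    by apply: le_measure => //; rewrite inE; [exact: measurableC|exact: measurableU].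
  (* Subadditivity adds the bounds of the two samples, whatever their joint law; this produces the
     leading factor 2 of [expR_deviation_level_le]. *)
  apply: le_trans (measureU2 _ _ _) _ => //.
  apply: le_trans (leeD (probability_overshoot henc hm hXS s0)
                        (probability_overshoot henc hm hXT s0)) _.
  rewrite -EFinD lee_fin -mulr2n -[leLHS]mulr_natl.
  exact: expR_deviation_level_le.
rewrite probability_setC// in bad.
rewrite EFinB leeBlDr//.
by rewrite addeC -leeBlDr// fin_num_measure.
Qed.
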